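(* Let $n,d$ be non-negative integers. Let $f:R\to S$ be a surjective ring homomorphism such that $S$ is projective both as a right $R$-module $S_R$ and as a left $R$-module ${}_RS$ (via $f$), and let $G$ be a right $S$-module. Then the following statements are equivalent: (1) $G$, regarded as a right $R$-module $G_R$ via $f$, is Gorenstein $(n,d)$-injective; (2) the right $S$-module $\mathrm{Hom}_R(S,G)$ is Gorenstein $(n,d)$-injective; (3) the right $S$-module $G_S$ is Gorenstein $(n,d)$-injective.
   Context: Rings are associative with non-zero identity and modules are unitary. The following definitions are over an arbitrary ring $T$. A right $T$-module $U$ is $n$-presented if there is an exact sequence $F_n\to F_{n-1}\to\cdots\to F_1\to F_0\to U\to 0$ of right $T$-modules with each $F_i$ finitely generated free. A right $T$-module $M$ is $(n,d)$-injective if $\mathrm{Ext}_T^{d+1}(U,M)=0$ for every $n$-presented right $T$-module $U$. A right $T$-module $G$ is Gorenstein $(n,d)$-injective if there is an exact sequence $\mathbf{A}=\cdots\to A_1\to A_0\to A^0\to A^1\to\cdots$ of $(n,d)$-injective right $T$-modules with $G=\ker(A^0\to A^1)$ such that the complex $\mathrm{Ext}_T^d(U,\mathbf{A})$ (obtained by applying $\mathrm{Ext}_T^d(U,-)$ to $\mathbf A$) is exact for every $n$-presented right $T$-module $U$ with finite projective dimension $\mathrm{pd}_T(U)<\infty$. Here $\mathrm{Hom}_R(S,G)$ is the group of right $R$-linear maps $S_R\to G_R$, with the right $S$-module structure induced by left multiplication of $S$ on itself. *)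

(* Defs.v *)
From HB Require Import structures.
From mathcomp Require Import all_boot all_algebra.
From mathcomp Require Import generic_quotient ring_quotient.
From mathcomp Require Import boolp.
From mathcomp Require Import freeg.

(* Modules over a ring T are T-lmodTypes, i.e. left modules; the theory below is
   written for those.  A right T-module is a left module over the converse ring
   T^c: v.t is written t *: v, and a *: (b *: v) = (b * a) *: v, with the product
   of T, is the right module law. *)

Set Implicit Arguments.
Unset Strict Implicit.
Unset Printing Implicit Defensive.

Import GRing.Theory.
Local Open Scope ring_scope.
Local Open Scope quotient_scope.

Notation rmodType T := (lmodType T^c).

Definition surjective (A B : Type) (f : A -> B) : Prop :=
  forall y, exists x, f x = y.

(* ker g = im f *)
Definition exact_at (A B : Type) (C : zmodType) (f : A -> B) (g : B -> C) :=
  forall y, g y = 0 <-> exists x, f x = y.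

Section linHom.
Variables (T : nzRingType) (U V : lmodType T).

Definition linHom : Type := {linear U -> V}.

Lemma linHom_ext (f g : {linear U -> V}) : f =1 g -> f = g.
Proof.
case: f g => f [[f1] [f2]] [g [[g1] [g2]]] /= /funext eq_fg.
case: _ / eq_fg g1 g2 => g1 g2.
by rewrite (Prop_irrelevance f1 g1) (Prop_irrelevance f2 g2).
Qed.

HB.instance Definition _ := gen_eqMixin linHom.
HB.instance Definition _ := gen_choiceMixin linHom.

Definition linHom_zero : linHom := \0.
Definition linHom_opp (f : linHom) : linHom := \- (f : {linear U -> V}).
Definition linHom_add (f g : linHom) : linHom :=
  (f : {linear U -> V}) \+ (g : {linear U -> V}).

Fact linHom_addA : associative linHom_add.
Proof. by move=> f g h; apply: linHom_ext => x /=; rewrite addrA. Qed.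
Fact linHom_addC : commutative linHom_add.
Proof. by move=> f g; apply: linHom_ext => x /=; rewrite addrC. Qed.
Fact linHom_add0 : left_id linHom_zero linHom_add.
Proof. by move=> f; apply: linHom_ext => x /=; rewrite add0r. Qed.
Fact linHom_addN : left_inverse linHom_zero linHom_opp linHom_add.
Proof. by move=> f; apply: linHom_ext => x /=; rewrite addNr. Qed.

HB.instance Definition _ :=
  GRing.isZmodule.Build linHom linHom_addA linHom_addC linHom_add0 linHom_addN.

End linHom.

Definition projective (T : nzRingType) (P : lmodType T) : Prop :=
  forall (M N : lmodType T) (g : {linear M -> N}) (h : {linear P -> N}),
    surjective g -> exists k : {linear P -> M}, forall x, g (k x) = h x.

Definition fg_free (T : nzRingType) (F : lmodType T) : Prop :=
  exists (k : nat) (e : {linear 'rV[T]_k -> F}), bijective e.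

(* A sequence ... -> X_2 -> X_1 -> X_0 -> U, with no condition on the maps. *)
Record augmented (T : nzRingType) (U : lmodType T) := Augmented {
  term :> nat -> lmodType T;
  bnd : forall i, {linear term i.+1 -> term i};
  aug : {linear term 0%N -> U}
}.

Section Augmented.
Variables (T : nzRingType) (U : lmodType T).

Definition exact_at_term (X : augmented U) (i : nat) : Prop :=
  match i with
  | 0 => exact_at (bnd X 0) (aug X)
  | j.+1 => exact_at (bnd X j.+1) (bnd X j)
  end.

(* The terms of X of index > n play no role. *)
Definition n_presented (n : nat) : Prop :=
  exists X : augmented U,
    [/\ forall i, (i <= n)%N -> fg_free (X i),
        forall i, (i < n)%N -> exact_at_term X i
      & surjective (aug X)].

Definition proj_resolution (X : augmented U) : Prop :=
  [/\ forall i, projective (X i), forall i, exact_at_term X i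
    & surjective (aug X)].

Definition finite_pd : Prop :=
  exists2 X : augmented U, proj_resolution X &
    exists m : nat, forall i, (m < i)%N -> forall x : X i, x = 0.

End Augmented.

(* Every module has a projective resolution (by free modules); only this last
   statement, proj_resolution_exists, matters below. *)
Section FreeModule.
Variables (T : nzRingType) (K : choiceType).
Local Notation F := ({freeg K / T} : lmodType T).

Lemma freeg_lift (M : lmodType T) (b : K -> M) :
  exists h : {linear F -> M}, forall k x, h (Freeg [:: (k, x)]) = k *: b x.
Proof.
have liftB := @lift_is_additive T K M b.
have liftZ : scalable (fglift b : F -> M).
  move=> a D.
  pose H := GRing.isZmodMorphism.Build _ _ (fglift b : F -> M) liftB.
  pose h : {additive F -> M} := HB.pack (fglift b : F -> M) H.
  rewrite -[fglift b]/(h : F -> M).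
  rewrite -[in RHS](freeg_sumE D) [a *: D]/(fgscale a D) /fgscale !raddf_sum.
  by apply: eq_bigr => x _; rewrite /h /= !liftU scalerA.
pose H1 := GRing.isZmodMorphism.Build _ _ (fglift b : F -> M) liftB.
pose H2 := GRing.isScalable.Build _ _ _ _ (fglift b : F -> M) liftZ.
pose h : {linear F -> M} := HB.pack (fglift b : F -> M) H1 H2.
by exists h => k x; apply: liftU.
Qed.

Lemma freeg_projective : projective F.
Proof.
move=> M N g h /choice[s gs].
have [k hk] := freeg_lift (fun x => s (h (Freeg [:: (1, x)]))).
exists k; elim/freeg_ind_dom0 => [|c x D _ _ IH]; first by rewrite !raddf0.
rewrite !raddfD /= IH; congr (_ + _).
have -> : Freeg [:: (c, x)] = c *: Freeg [:: (1, x)] :> F.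
  by apply/eqP/freeg_eqP => y; rewrite coeffZ !coeffU mul1r.
by rewrite !linearZ /= hk scale1r gs.
Qed.
End FreeModule.

Section Resolution.
Variable T : nzRingType.

Section Kernel.
Variables (M N : lmodType T) (p : {linear M -> N}).
Definition is_ker : {pred M} := fun x => p x == 0.
Fact is_ker_submod : submod_closed is_ker.
Proof.
split=> [|a x y]; rewrite /is_ker !unfold_in ?raddf0 // => /eqP px /eqP py.
by rewrite linearP px py scaler0 addr0.
Qed.
HB.instance Definition _ := GRing.isSubmodClosed.Build T M is_ker is_ker_submod.
Record ker := Ker { ker_val : M; _ : ker_val \in is_ker }.
HB.instance Definition _ := [isSub for ker_val].
HB.instance Definition _ := [Choice of ker by <:].
HB.instance Definition _ := [SubChoice_isSubLmodule of ker by <:].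
End Kernel.

Definition free_cover (U : lmodType T) :
  {p : {P : lmodType T & {linear P -> U}} | projective (projT1 p) /\ surjective (projT2 p)}.
Proof.
apply: cid.
have [h hh] := freeg_lift (@id U).
exists (existT (fun P : lmodType T => {linear P -> U})
  ({freeg U / T} : lmodType T) h); split; first exact: freeg_projective.
by move=> y; exists (Freeg [:: (1, y)]); rewrite hh scale1r.
Qed.

Let cov U := projT1 (sval (free_cover U)).
Let cmap U : {linear cov U -> U} := projT2 (sval (free_cover U)).
Fixpoint syz (U : lmodType T) i : lmodType T :=
  if i is j.+1 then ker (cmap (syz U j)) else U.

Lemma proj_resolution_exists (U : lmodType T) : exists X : augmented U, proj_resolution X.
Proof.
pose incl (M N : lmodType T) (p : {linear M -> N}) : {linear ker p -> M} := val.
pose inc i : {linear syz U i.+1 -> cov (syz U i)} := incl _ _ (cmap (syz U i)).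
pose X := @Augmented T U (fun i => cov (syz U i))
  (fun i => inc i \o cmap (syz U i.+1)) (cmap U).
exists X; split=> [i|i|]; [exact: (svalP (free_cover _)).1| |exact: (svalP (free_cover U)).2].
have ex j : exact_at (inc j \o cmap (syz U j.+1)) (cmap (syz U j)).
  move=> y; split=> [y0|[x <-]].
    have [x xE] := (svalP (free_cover (syz U j.+1))).2
      (@Ker _ _ (cmap (syz U j)) y (introT eqP y0)).
    by exists x; rewrite /= -/(cmap _) [cmap _ x]xE.
  by rewrite /=; case: (cmap _ x) => z /= /eqP.
case: i => [|i]; first exact: ex.
move=> y; rewrite -(ex i.+1 y) /=; split=> [/eqP|->]; last exact: (raddf0 (inc i)).
by move=> /eqP E; apply: val_inj; exact: E.
Qed.
End Resolution.

(* Ext^d(U, M) is the d-th cohomology group of Hom(X, M) for a projective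
   resolution X of U.  As X is an argument of Ext, each statement about
   Ext^d(U, -) is made for all projective resolutions X of U; there is one by
   proj_resolution_exists, and which one is used is immaterial. *)
Section Ext.
Variables (T : nzRingType) (U : lmodType T) (X : augmented U).

Section Group.
Variables (d : nat) (M : lmodType T).

Definition is_cocycle : {pred linHom (X d) M} :=
  fun f : {linear X d -> M} => `[< forall x, f (bnd X d x) = 0 >].

Fact is_cocycle_zmod : zmod_closed is_cocycle.
Proof.
split=> [|f g /asboolP f0 /asboolP g0]; apply/asboolP => x //=.
by rewrite f0 g0 subr0.
Qed.
HB.instance Definition _ := GRing.isZmodClosed.Build _ is_cocycle is_cocycle_zmod.

Record cocycle := Cocycle {
  cocycle_val : linHom (X d) M;
  _ : cocycle_val \in is_cocycle
}.
HB.instance Definition _ := [isSub for cocycle_val].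
HB.instance Definition _ := [Choice of cocycle by <:].
HB.instance Definition _ := [SubChoice_isSubZmodule of cocycle by <:].

Definition coboundary : linHom (X d) M -> Prop :=
  match d with
  | 0 => fun f => f = 0
  | e.+1 => fun f : {linear X e.+1 -> M} =>
              exists g : {linear X e -> M}, f =1 g \o bnd X e
  end.

Fact coboundary0 : coboundary 0.
Proof. by rewrite /coboundary; case: d => [//|e]; exists \0. Qed.

Fact coboundaryB f g : coboundary f -> coboundary g -> coboundary (f - g).
Proof.
rewrite /coboundary; case: d f g => [|e] f g; first by move=> -> ->; rewrite subr0.
move=> [f' eq_f] [g' eq_g]; exists (f' \- g') => x.
by rewrite /= -[f x]/((f : {linear _ -> _}) x) eq_f eq_g.
Qed.

(* When X is a complex, every coboundary is a cocycle. *)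
Definition is_coboundary : {pred cocycle} :=
  fun f => `[< coboundary (cocycle_val f) >].

Fact is_coboundary_zmod : zmod_closed is_coboundary.
Proof.
split=> [|f g /asboolP f0 /asboolP g0]; apply/asboolP; first exact: coboundary0.
exact: coboundaryB.
Qed.
HB.instance Definition _ :=
  GRing.isZmodClosed.Build _ is_coboundary is_coboundary_zmod.

Definition Ext : zmodType := Quotient.quot is_coboundary.

Definition ext_class (f : cocycle) : Ext := \pi_(Quotient.quot is_coboundary) f.

End Group.
Arguments is_cocycle d M : clear implicits.
Arguments is_coboundary d M : clear implicits.

Section Functor.
Variables (d : nat) (M N : lmodType T) (a : {linear M -> N}).

Definition comp_linHom (f : {linear X d -> M}) : linHom (X d) N := a \o f.

Fact comp_linHom_cocycle (f : cocycle d M) :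
  comp_linHom (cocycle_val f) \in is_cocycle d N.
Proof.
by apply/asboolP => x /=; case: f => f /= /asboolP ->; rewrite raddf0.
Qed.
Definition push (f : cocycle d M) : cocycle d N := Cocycle (comp_linHom_cocycle f).

(* Given by representatives; push preserves coboundaries by Ext_mapE. *)
Definition Ext_map (c : Ext d M) : Ext d N :=
  ext_class (push (repr (c : Quotient.quot (is_coboundary d M)))).

Lemma Ext_mapE (f : cocycle d M) : Ext_map (ext_class f) = ext_class (push f).
Proof.
rewrite /Ext_map /ext_class; case: piP => g /eqmodP.
rewrite /= /Quotient.equiv -[_ \in _]rpredN opprB => /asboolP fg.
apply/eqmodP/asboolP.
have -> : cocycle_val (push g - push f) = comp_linHom (cocycle_val (g - f)).
  by apply: linHom_ext => x /=; rewrite raddfB.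
move: (cocycle_val _) fg; rewrite /coboundary /comp_linHom; case: (d) => [|e] h.
  by move=> ->; apply: linHom_ext => x /=; rewrite raddf0.
by move=> [k hk]; exists (a \o k) => x /=; rewrite hk.
Qed.

End Functor.
End Ext.
Arguments Ext_map {T U} X d {M N} a c.

Section Injectivity.
Variables (T : nzRingType) (n d : nat).

Definition nd_injective (M : lmodType T) : Prop :=
  forall U : lmodType T, n_presented U n ->
  forall X : augmented U, proj_resolution X ->
  forall c : Ext X d.+1 M, c = 0.

(* The complex is indexed by int: A_k is A (- k - 1) and A^k is A k, with
   differential D i : A i -> A (i + 1).  Exactness is stated at A (i + 1), for
   all i.  The equality G = ker (A^0 -> A^1) is given by an embedding of G in
   A^0 whose image is the kernel. *)
Definition Gorenstein_nd_injective (G : lmodType T) : Prop :=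
  exists (A : int -> lmodType T) (D : forall i, {linear A i -> A (i + 1)}),
    [/\ forall i, nd_injective (A i),
        forall i, exact_at (D i) (D (i + 1)),
        (exists iota : {linear G -> A 0}, injective iota /\ exact_at iota (D 0))
      & forall U : lmodType T, n_presented U n -> finite_pd U ->
        forall X : augmented U, proj_resolution X ->
        forall i, exact_at (Ext_map X d (D i)) (Ext_map X d (D (i + 1)))].

End Injectivity.

(* V with the A-module structure a *: v := f a *: v *)
Definition restrict (A B : nzRingType) (f : {rmorphism A -> B}) (V : lmodType B) :
  Type := V.

Section Restriction.
Variables (A B : nzRingType) (f : {rmorphism A -> B}) (V : lmodType B).

HB.instance Definition _ := GRing.Zmodule.on (restrict f V).

Let scale (a : A) (v : V) : V := f a *: v.

Fact restrict_scaleA a b (v : restrict f V) : scale a (scale b v) = scale (a * b) v.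
Proof. by rewrite /scale scalerA rmorphM. Qed.
Fact restrict_scale1 : left_id 1 (scale : A -> restrict f V -> restrict f V).
Proof. by move=> v; rewrite /scale rmorph1 scale1r. Qed.
Fact restrict_scaleDr : right_distributive (scale : A -> restrict f V -> restrict f V) +%R.
Proof. by move=> a u v; rewrite /scale scalerDr. Qed.
Fact restrict_scaleDl (v : restrict f V) :
  {morph (scale^~ v : A -> restrict f V) : a b / a + b}.
Proof. by move=> a b; rewrite /scale rmorphD scalerDl. Qed.

HB.instance Definition _ := GRing.Zmodule_isLmodule.Build A (restrict f V)
  restrict_scaleA restrict_scale1 restrict_scaleDr restrict_scaleDl.
End Restriction.

Section Converse.
Variables (R S : nzRingType) (f : {rmorphism R -> S}).

Definition conv_fun : R^c -> S^c := f.

Fact conv_fun_zmod : zmod_morphism conv_fun.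
Proof. exact: (rmorphB f). Qed.
Fact conv_fun_monoid : monoid_morphism conv_fun.
Proof. by split=> [|x y]; [exact: (rmorph1 f) | exact: (rmorphM f)]. Qed.
HB.instance Definition _ :=
  GRing.isZmodMorphism.Build _ _ conv_fun conv_fun_zmod.
HB.instance Definition _ :=
  GRing.isMonoidMorphism.Build _ _ conv_fun conv_fun_monoid.

(* f as a morphism between the converse rings *)
Definition converse_morph : {rmorphism R^c -> S^c} := conv_fun.
End Converse.

(* Hom_R(S, G) for a right S-module G: the right R-linear maps from S to G, with
   (phi.s)(x) = phi(s x). *)
Section CoExtension.
Variables (R S : nzRingType) (f : {rmorphism R -> S}).

(* S as a right and as a left R-module *)
Definition right_reg : rmodType R :=
  restrict (converse_morph f) (GRing.regular S^c).
Definition left_reg : lmodType R := restrict f (GRing.regular S).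

Variable G : rmodType S.

(* G as a right R-module *)
Definition G_R : rmodType R := restrict (converse_morph f) G.
Definition HomRS : Type := linHom right_reg G_R.
HB.instance Definition _ := GRing.Zmodule.on HomRS.

Definition HomRS_lmul (s : S) (x : right_reg) : right_reg := s * (x : S).

Fact HomRS_lmul_linear s : linear (HomRS_lmul s).
Proof.
move=> a x y; rewrite /HomRS_lmul.
have -> : s * (a *: x + y : right_reg) = s * ((x : S) * f a + (y : S)) :> S by [].
by rewrite mulrDr mulrA.
Qed.
HB.instance Definition _ s := GRing.isLinear.Build _ _ _ _ (HomRS_lmul s)
  (HomRS_lmul_linear s).

Definition HomRS_act (s : S^c) (phi : HomRS) : HomRS :=
  (phi : {linear right_reg -> G_R}) \o HomRS_lmul s.

Fact HomRS_actA a b phi : HomRS_act a (HomRS_act b phi) = HomRS_act (a * b) phi.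
Proof.
apply: linHom_ext => x /=; congr ((phi : {linear _ -> _}) _).
by rewrite /HomRS_lmul mulrA.
Qed.
Fact HomRS_act1 : left_id 1 HomRS_act.
Proof.
move=> phi; apply: linHom_ext => x /=; congr ((phi : {linear _ -> _}) _).
exact: (@mul1r S x).
Qed.
Fact HomRS_actDr : right_distributive HomRS_act +%R.
Proof. by move=> a phi psi; apply: linHom_ext. Qed.
Fact HomRS_actDl phi : {morph HomRS_act^~ phi : a b / a + b}.
Proof.
move=> a b; apply: linHom_ext => x /=.
rewrite -(raddfD (phi : {linear _ -> _})).
by congr ((phi : {linear _ -> _}) _); rewrite /HomRS_lmul mulrDl.
Qed.

HB.instance Definition _ := GRing.Zmodule_isLmodule.Build S^c HomRS
  HomRS_actA HomRS_act1 HomRS_actDr HomRS_actDl.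

End CoExtension.

(* Main.v *)
(* As S = R/I is projective on both sides, I is generated by a central idempotent:
   R = S x R' as rings.  Restriction of scalars along R -> S and the functor cut
   taking an R-module M to its S-component are then exact and adjoint to each
   other on both sides, so both preserve projective resolutions, hence finite
   projective dimension, and the adjunction isomorphisms of Hom complexes
   identify the Ext groups over R and S.  Restriction preserves n-presented
   modules although S is only projective over R, since R'^k is also
   n-presented for all n, with resolution ... -> R^k -> R^k -> R'^k.  Thus
   restriction and cut carry the complexes witnessing the Gorenstein property
   from one side to the other.  Finally Hom_R(S, G) = G because R -> S is onto. *)

From HB Require Import structures.
Require Import Defs.
From mathcomp Require Import all_boot all_algebra.
From mathcomp Require Import generic_quotient ring_quotient boolp.

Set Implicit Arguments.
Unset Strict Implicit.
Unset Printing Implicit Defensive.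

Import GRing.Theory.
Local Open Scope ring_scope.
Local Open Scope quotient_scope.

(** * Vanishing and exactness of Ext in terms of cochains *)

Section ExtElementary.
Variables (T : nzRingType) (U : lmodType T) (X : augmented U) (d : nat).

Definition cocycle_map (M : lmodType T) (h : linHom (X d) M) : Prop :=
  forall x, (h : {linear X d -> M}) (bnd X d x) = 0.

Lemma cocycle_mapP (M : lmodType T) (h : linHom (X d) M) :
  cocycle_map h <-> h \in @is_cocycle T U X d M.
Proof. by split=> [h0|/asboolP]; first apply/asboolP. Qed.

Lemma ext_class_surj (M : lmodType T) (c : Ext X d M) :
  exists f : cocycle X d M, c = ext_class f.
Proof. by exists (repr (c : Quotient.quot _)); rewrite /ext_class reprK. Qed.

Lemma eq_ext_class (M : lmodType T) (f g : cocycle X d M) :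
  ext_class f = ext_class g <-> coboundary (cocycle_val f - cocycle_val g).
Proof.
rewrite /ext_class; split=> [/eqmodP|fg].
  by rewrite /= /Quotient.equiv => /asboolP.
by apply/eqmodP/asboolP.
Qed.

Lemma ext_class_eq0 (M : lmodType T) (f : cocycle X d M) :
  ext_class f = 0 <-> coboundary (cocycle_val f).
Proof.
have -> : (0 : Ext X d M) = ext_class 0.
  rewrite /ext_class.
  by rewrite -[RHS]/(\pi_(Quotient.quot (@is_coboundary T U X d M)) 0) raddf0.
by rewrite eq_ext_class subr0.
Qed.

Lemma Ext_eq0P (M : lmodType T) :
  (forall c : Ext X d M, c = 0) <->
  (forall h : linHom (X d) M, cocycle_map h -> coboundary h).
Proof.
split=> [c0 h /cocycle_mapP h0|H c].
  by have /ext_class_eq0 := c0 (ext_class (Cocycle h0)).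
have [f ->] := ext_class_surj c; apply/ext_class_eq0/H/cocycle_mapP.
exact: valP f.
Qed.

(** Representatives replace classes: in this form exactness speaks only of cocycles and
    coboundaries, which an isomorphism of Hom complexes transports. *)
Lemma Ext_map_exactP (M N P : lmodType T) (a : {linear M -> N})
    (b : {linear N -> P}) :
  exact_at (Ext_map X d a) (Ext_map X d b) <->
  (forall h : linHom (X d) N, cocycle_map h ->
     coboundary (comp_linHom b h) <->
     exists2 k : linHom (X d) M, cocycle_map k &
       coboundary (comp_linHom a k - h)).
Proof.
split=> [H h /cocycle_mapP h0|H c].
  have := H (ext_class (Cocycle h0)); rewrite Ext_mapE ext_class_eq0 => ->.
  split=> [[c]|[k /cocycle_mapP k0 kh]].
    have [k ->] := ext_class_surj c; rewrite Ext_mapE => /eq_ext_class kh.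
    by exists (cocycle_val k) => //; apply/cocycle_mapP; apply: valP k.
  by exists (ext_class (Cocycle k0)); rewrite Ext_mapE; apply/eq_ext_class.
have [h ->] := ext_class_surj c; rewrite Ext_mapE ext_class_eq0.
have /cocycle_mapP/H-> := valP h; split=> [[k /cocycle_mapP k0 kh]|[c']].
  by exists (ext_class (Cocycle k0)); rewrite Ext_mapE; apply/eq_ext_class.
have [k ->] := ext_class_surj c'; rewrite Ext_mapE => /eq_ext_class kh.
by exists (cocycle_val k) => //; apply/cocycle_mapP; apply: valP k.
Qed.

End ExtElementary.

(** * Isomorphisms between Hom complexes over two rings *)

Section HomComplexIso.
Variables (T T' : nzRingType) (U : lmodType T) (U' : lmodType T').
Variables (X : augmented U) (X' : augmented U').

(** As [T] and [T'] differ, the Hom groups are compared as abelian groups only; compatibility with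
    [-] is enough for additivity. *)
Record hom_complex_iso (M : lmodType T) (M' : lmodType T') := HomComplexIso {
  hom_iso :> forall k, linHom (X k) M -> linHom (X' k) M';
  hom_isoB : forall k, {morph @hom_iso k : h l / h - l};
  hom_iso_bij : forall k, bijective (@hom_iso k);
  hom_iso_bnd : forall k (h : {linear X k -> M}),
    @hom_iso k.+1 (h \o bnd X k) =
    (@hom_iso k h : {linear X' k -> M'}) \o bnd X' k :> {linear _ -> _} }.

Lemma hom_iso0 M M' (phi : hom_complex_iso M M') k : phi k 0 = 0.
Proof. by have := hom_isoB phi 0 (0 : linHom (X k) M); rewrite !subrr. Qed.

Lemma hom_iso_eq0 M M' (phi : hom_complex_iso M M') k h :
  phi k h = 0 <-> h = 0.
Proof.
split=> [|->]; last exact: hom_iso0.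
by rewrite -(hom_iso0 phi k) => /(bij_inj (hom_iso_bij phi k)).
Qed.

Lemma hom_iso_cocycle M M' (phi : hom_complex_iso M M') d h :
  cocycle_map (phi d h) <-> cocycle_map h.
Proof.
split=> [h0|h0] x.
  have E : phi d.+1 ((h : {linear _ -> _}) \o bnd X d) = 0.
    by rewrite hom_iso_bnd; apply: linHom_ext => y; apply: h0.
  by move/hom_iso_eq0 : E => E; apply: (congr1 (fun l : {linear _ -> _} => l x) E).
have E : (h : {linear _ -> _}) \o bnd X d = 0 :> linHom _ _.
  by apply: linHom_ext => y; apply: h0.
move/(hom_iso_eq0 phi): E; rewrite hom_iso_bnd => E.
exact: (congr1 (fun l : {linear _ -> _} => l x) E).
Qed.

Lemma hom_iso_coboundary M M' (phi : hom_complex_iso M M') d h :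
  coboundary (phi d h) <-> coboundary h.
Proof.
case: d h => [|d] h /=; first exact: hom_iso_eq0.
split=> [[l hl]|[l hl]].
  have [psi _ psiK] := hom_iso_bij phi d.
  exists (psi l) => x.
  suff -> : h = (psi l : {linear _ -> _}) \o bnd X d :> linHom _ _ by [].
  apply: (bij_inj (hom_iso_bij phi d.+1)); rewrite hom_iso_bnd psiK.
  exact: linHom_ext.
exists (phi d l) => x.
have -> : h = (l : {linear _ -> _}) \o bnd X d :> linHom _ _ by apply: linHom_ext.
by rewrite hom_iso_bnd.
Qed.

Lemma hom_iso_Ext_eq0 M M' (phi : hom_complex_iso M M') d :
  (forall c : Ext X' d M', c = 0) -> forall c : Ext X d M, c = 0.
Proof.
move/Ext_eq0P => H; apply/Ext_eq0P => h h0.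
by apply/(hom_iso_coboundary phi)/H/hom_iso_cocycle.
Qed.

(** Naturality in degree [d] suffices: coboundaries are transported within each complex separately,
    by [hom_iso_coboundary]. *)
Lemma hom_iso_Ext_exact (M N P : lmodType T) (M' N' P' : lmodType T')
    (a : {linear M -> N}) (b : {linear N -> P})
    (a' : {linear M' -> N'}) (b' : {linear N' -> P'})
    (phiM : hom_complex_iso M M') (phiN : hom_complex_iso N N')
    (phiP : hom_complex_iso P P') (d : nat) :
    (forall h, phiN d (comp_linHom a h) = comp_linHom a' (phiM d h)) ->
    (forall h, phiP d (comp_linHom b h) = comp_linHom b' (phiN d h)) ->
  exact_at (Ext_map X' d a') (Ext_map X' d b') ->
  exact_at (Ext_map X d a) (Ext_map X d b).
Proof.
move=> nat_a nat_b /Ext_map_exactP H; apply/Ext_map_exactP => h h0.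
rewrite -(hom_iso_coboundary phiP) nat_b H; last exact/hom_iso_cocycle.
split=> [[k' k0 kh]|[k k0 kh]].
  have [psi _ psiK] := hom_iso_bij phiM d.
  exists (psi k'); first by apply/(hom_iso_cocycle phiM); rewrite psiK.
  by apply/(hom_iso_coboundary phiN); rewrite hom_isoB nat_a psiK.
exists (phiM d k); first exact/hom_iso_cocycle.
by rewrite -nat_a -hom_isoB; apply/hom_iso_coboundary.
Qed.

End HomComplexIso.

Definition mk_linear (T : nzRingType) (U V : lmodType T) (f : U -> V)
    (f_lin : linear f) : {linear U -> V} :=
  HB.pack f (GRing.isLinear.Build T U V *:%R f f_lin).

Lemma ker_valP (T : nzRingType) (U V : lmodType T) (p : {linear U -> V}) (x : ker p) :
  p (val x) = 0.
Proof. by case: x => x /= /eqP. Qed.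

(** * Finitely generated free and n-presented modules *)

Section Presentations.
Variable T : nzRingType.
Implicit Types U V : lmodType T.

Lemma fg_free_rV k : fg_free ('rV[T]_k : lmodType T).
Proof. by exists k, idfun; exists id. Qed.

Lemma fg_free_prod U V : fg_free U -> fg_free V -> fg_free (U * V : lmodType T)%type.
Proof.
move=> [k [e [e' eK eK']]] [l [f [f' fK fK']]].
pose h (x : 'rV[T]_(k + l)) := (e (lsubmx x), f (rsubmx x)).
have hL : linear h by move=> a x y; rewrite /h !linearP.
exists (k + l)%N, (mk_linear hL).
exists (fun x => row_mx (e' x.1) (f' x.2)) => [x|[x y]] /=.
  by rewrite eK fK hsubmxK.
by rewrite /h row_mxKl row_mxKr eK' fK'.
Qed.

(** Dimension shift, for induction on [n]: a presentation is cut at the kernel of its augmentation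
    and, conversely, a presentation of [K] is spliced onto [F] along [i]. *)
Lemma n_presentedS n U :
  n_presented U n.+1 <->
  exists (F K : lmodType T) (i : {linear K -> F}) (p : {linear F -> U}),
    [/\ fg_free F, injective i, exact_at i p, surjective p & n_presented K n].
Proof.
split=> [[X [Xfree Xex Xsurj]]|[F [K [i [p]]]]].
  pose K : lmodType T := ker (aug X).
  pose i : {linear K -> X 0} := val.
  have iK y : aug X y = 0 -> {z : K | i z = y}.
    by move=> /eqP y0; exists (@Ker _ _ _ (aug X) y y0).
  have ex0 := Xex 0 isT.
  have aug0 x : aug X (bnd X 0 x) = 0 by apply/ex0; exists x.
  (* The first differential, corestricted to the kernel, is the augmentation of the shifted
     presentation. *)
  pose q x : K := sval (iK _ (aug0 x)).
  have iq x : i (q x) = bnd X 0 x by rewrite /q; case: (iK _ _).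
  have i_inj : injective i by apply: val_inj.
  have qL : linear q.
    by move=> a x y; apply: i_inj; rewrite linearP !iq linearP.
  exists (X 0), K, i, (aug X); split=> //; first exact: Xfree.
    by move=> y; split=> [/iK[z <-]|[[z z0] <-]]; [exists z | apply: (ker_valP (Ker z0))].
  exists (@Augmented T K (fun j => X j.+1) (fun j => bnd X j.+1) (mk_linear qL)).
  split=> [j jn|j jn|y] /=; first exact: Xfree.
    case: j jn => [|j] jn /=; last exact: (Xex j.+2 jn).
    move=> y /=; have /= <- := Xex 1 jn y; rewrite -iq.
    split=> [->|]; first exact: raddf0.
    by rewrite -[RHS](raddf0 i) => /i_inj.
  have [|x xy] := (ex0 (i y)).1; last by exists x; apply: i_inj; rewrite iq.
  exact: ker_valP.
move=> [Ffree i_inj ip p_surj [Y [Yfree Yex Ysurj]]].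
pose t j := if j is j'.+1 then Y j' else F.
pose b j : {linear t j.+1 -> t j} :=
  if j is j'.+1 return {linear t j.+1 -> t j} then bnd Y j'
  else (i \o aug Y : {linear _ -> _}).
exists (@Augmented T U t b p); split=> //=.
  by case=> [|j] jn //=; apply: Yfree.
case=> [|[|j]] jn /=; last exact: (Yex j.+1 jn).
  move=> y; rewrite ip; split=> [[k <-]|[x <-]]; last by exists (aug Y x).
  by have [x <-] := Ysurj k; exists x.
move=> y; have /= <- := Yex 0 jn y; split=> [|->]; last exact: (raddf0 i).
by rewrite -[RHS](raddf0 i) => /i_inj.
Qed.

Lemma n_presented0 U :
  n_presented U 0 <->
  exists2 F : lmodType T, fg_free F & exists p : {linear F -> U}, surjective p.
Proof.
split=> [[X [Xfree _ Xsurj]]|[F Ffree [p p_surj]]].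
  by exists (X 0); [exact: Xfree | exists (aug X)].
by exists (@Augmented T U (fun=> F) (fun=> \0) p).
Qed.

Lemma n_presented_prod n U V :
  n_presented U n -> n_presented V n -> n_presented (U * V : lmodType T)%type n.
Proof.
move=> [X [Xfree Xex Xsurj]] [Y [Yfree Yex Ysurj]].
pose t i : lmodType T := (X i * Y i)%type.
have bL i : linear (fun x : t i.+1 => (bnd X i x.1, bnd Y i x.2) : t i).
  by move=> a x y; rewrite !linearP.
have aL : linear (fun x : t 0 => (aug X x.1, aug Y x.2) : (U * V)%type).
  by move=> a x y; rewrite !linearP.
exists (@Augmented T _ t (fun i => mk_linear (bL i)) (mk_linear aL)); split=> /=.
- by move=> i iN; apply: fg_free_prod; [apply: Xfree | apply: Yfree].
- have ex_prod (A B C A' B' C' : zmodType) (f : A -> B) (g : B -> C)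
      (f' : A' -> B') (g' : B' -> C') : exact_at f g -> exact_at f' g' ->
      exact_at (fun x : A * A' => (f x.1, f' x.2)) (fun x => (g x.1, g' x.2)).
    move=> fg fg' [y y']; split=> [[/fg[x <-] /fg'[x' <-]]|[[x x'] [<- <-]]] /=.
      by exists (x, x').
    by congr (_, _); [apply/fg; exists x | apply/fg'; exists x'].
  by case=> [|i] iN; apply: ex_prod; [exact: (Xex 0)|exact: (Yex 0)|
    exact: (Xex i.+1)|exact: (Yex i.+1)].
- move=> [x y]; have [x' <-] := Xsurj x; have [y' <-] := Ysurj y.
  by exists (x', y').
Qed.

End Presentations.

(** * The central idempotent and the factor of a module that it cuts out *)

Section Split.
Variables A B : nzRingType.

(* g splits as a map of A-A-bimodules: then sec 1 is a central idempotent and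
   B is the factor (sec 1) A of A. *)
Record bimodule_section (g : {rmorphism A -> B}) := BimoduleSection {
  sec :> B -> A;
  secB : {morph sec : x y / x - y};
  secMl : forall a b, sec (g a * b) = a * sec b;
  secMr : forall a b, sec (b * g a) = sec b * a;
  secK : cancel sec g }.

Variables (g : {rmorphism A -> B}) (s : bimodule_section g).

Lemma secD x y : s (x + y) = s x + s y.
Proof. by apply/eqP; rewrite -subr_eq -secB addrK. Qed.

(** Writing [x] as [g (s x)] turns left linearity into multiplicativity, so [s] embeds [B] in [A] as
    a ring, up to the identity. *)
Lemma secM x y : s (x * y) = s x * s y.
Proof. by rewrite -{1}(secK s x) secMl. Qed.

(** Together with [secM1] this makes [s 1] central, and [s \o g] the multiplication by it. *)
Lemma sec1M a : s 1 * a = s (g a).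
Proof. by rewrite -secMr mul1r. Qed.

Lemma secM1 a : a * s 1 = s (g a).
Proof. by rewrite -secMl mulr1. Qed.

Lemma sec1_linear (M : lmodType A) : linear (fun x : M => s 1 *: x).
Proof. by move=> a x y; rewrite scalerDr !scalerA sec1M -secM1. Qed.

Definition sec1_map (M : lmodType A) : {linear M -> M} := mk_linear (@sec1_linear M).

Lemma compl_linear (M : lmodType A) : linear (fun x : M => x - s 1 *: x).
Proof. by move=> a x y; rewrite sec1_linear scalerBr opprD addrACA. Qed.

Definition compl_map (M : lmodType A) : {linear M -> M} := mk_linear (@compl_linear M).

(** This is the summand [s 1 *: M], given as a kernel to obtain it as a subtype. Only the group
    structure is copied, because the scalars will be those of [B]. *)
Definition cut (M : lmodType A) : Type := ker (compl_map M).
HB.instance Definition _ M := GRing.Zmodule.on (cut M).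

Variable M : lmodType A.

Definition cut_val (x : cut M) : M := val (x : ker _).

Lemma cut_val_inj : injective cut_val. Proof. exact: val_inj. Qed.

Lemma cut_valB : {morph cut_val : x y / x - y}.
Proof. exact: (@raddfB (ker (compl_map M)) M val). Qed.

Lemma cut_val0 : cut_val 0 = 0. Proof. exact: (@raddf0 (ker (compl_map M)) M val). Qed.

Lemma cut_valD : {morph cut_val : x y / x + y}.
Proof. exact: (@raddfD (ker (compl_map M)) M val). Qed.

Lemma sec1_cut_val x : s 1 *: cut_val x = cut_val x.
Proof.
by apply/esym/eqP; rewrite -subr_eq0; apply/eqP/(ker_valP (x : ker _)).
Qed.

Fact to_cut_subproof (x : M) : s 1 *: x \in is_ker (compl_map M).
Proof. by rewrite unfold_in /= scalerA -secM mulr1 subrr. Qed.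

Definition to_cut (x : M) : cut M := Ker (to_cut_subproof x).

Lemma to_cutK x : cut_val (to_cut x) = s 1 *: x. Proof. by []. Qed.

Lemma cut_valK : cancel cut_val to_cut.
Proof. by move=> x; apply: cut_val_inj; rewrite to_cutK sec1_cut_val. Qed.

(** Here [to_cut] serves to supply membership: as [s 1 * s b = s b], it does not change the
    value. *)
Definition cut_scale (b : B) (x : cut M) : cut M := to_cut (s b *: cut_val x).

Lemma cut_val_scale b x : cut_val (cut_scale b x) = s b *: cut_val x.
Proof. by rewrite to_cutK scalerA -secM mul1r. Qed.

Fact cut_scaleA a b x : cut_scale a (cut_scale b x) = cut_scale (a * b) x.
Proof. by apply: cut_val_inj; rewrite !cut_val_scale scalerA secM. Qed.
Fact cut_scale1 : left_id 1 cut_scale.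
Proof. by move=> x; apply: cut_val_inj; rewrite cut_val_scale sec1_cut_val. Qed.
Fact cut_scaleDr : right_distributive cut_scale +%R.
Proof.
move=> b x y; apply: cut_val_inj.
by rewrite cut_valD !cut_val_scale cut_valD scalerDr.
Qed.
Fact cut_scaleDl x : {morph cut_scale^~ x : a b / a + b}.
Proof.
move=> a b; apply: cut_val_inj.
by rewrite cut_valD !cut_val_scale secD scalerDl.
Qed.

HB.instance Definition _ := GRing.Zmodule_isLmodule.Build B (cut M)
  cut_scaleA cut_scale1 cut_scaleDr cut_scaleDl.

Lemma cut_valZ (b : B) (x : cut M) : cut_val (b *: x) = s b *: cut_val x.
Proof. exact: cut_val_scale. Qed.

(** The scalar [s (g a)] is [a * s 1], and [s 1] fixes the cut. *)
Lemma cut_valZg (a : A) (x : cut M) : cut_val (g a *: x) = a *: cut_val x.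
Proof. by rewrite cut_valZ -secM1 -scalerA sec1_cut_val. Qed.

Lemma to_cutD : {morph to_cut : x y / x + y}.
Proof. by move=> x y; apply: cut_val_inj; rewrite cut_valD !to_cutK scalerDr. Qed.

Lemma to_cutZ a x : to_cut (a *: x) = g a *: to_cut x.
Proof.
by apply: cut_val_inj; rewrite cut_valZg !to_cutK !scalerA sec1M secM1.
Qed.

End Split.

(** * Restriction of scalars on maps *)

Section Restrict.
Variables (A B : nzRingType) (g : {rmorphism A -> B}).

Lemma restrict_scaleE (N : lmodType B) (a : A) (x : restrict g N) :
  a *: x = (g a *: (x : N) : restrict g N).
Proof. by []. Qed.

Section Map.
Variables (N P : lmodType B) (h : {linear N -> P}).

Fact restrict_map_linear : linear (h : restrict g N -> restrict g P).
Proof. by move=> a x y; rewrite !restrict_scaleE; apply: (linearP h). Qed.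

Definition restrict_map : {linear restrict g N -> restrict g P} :=
  mk_linear restrict_map_linear.
End Map.
End Restrict.

(** * The two adjunctions between [cut] and restriction, and what both functors preserve *)

Section Adjunctions.
Variables (A B : nzRingType) (g : {rmorphism A -> B}) (s : bimodule_section g).

Section Cut.
Variables (M P : lmodType A) (h : {linear M -> P}).

Fact cut_map_linear : linear (fun x : cut s M => to_cut s (h (cut_val x))).
Proof.
move=> b x y; apply: cut_val_inj.
by rewrite cut_valD cut_valZ !to_cutK cut_valD cut_valZ linearP scalerDr
  !scalerA -!secM mulr1 mul1r.
Qed.

Definition cut_map : {linear cut s M -> cut s P} := mk_linear cut_map_linear.

Lemma cut_val_map x : cut_val (cut_map x) = h (cut_val x).
Proof. by rewrite /= to_cutK -linearZ /= sec1_cut_val. Qed.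
End Cut.

(* Hom_A(M, restrict N) = Hom_B(cut M, N) *)
Section LeftAdjoint.
Variables (M : lmodType A) (N : lmodType B).

Section Down.
Variable h : {linear M -> restrict g N}.
Fact from_restrict_linear : linear (fun x : cut s M => h (cut_val x) : N).
Proof.
by move=> b x y; rewrite cut_valD cut_valZ linearP restrict_scaleE secK.
Qed.
Definition from_restrict : {linear cut s M -> N} := mk_linear from_restrict_linear.
End Down.

Section Up.
Variable h : {linear cut s M -> N}.
Fact to_restrict_linear :
  linear (fun x : M => h (to_cut s x) : restrict g N).
Proof. by move=> a x y; rewrite to_cutD to_cutZ linearP. Qed.
Definition to_restrict : {linear M -> restrict g N} := mk_linear to_restrict_linear.
End Up.

Lemma from_restrictK : cancel (from_restrict : linHom _ _ -> linHom _ _)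
  (to_restrict : linHom _ _ -> linHom _ _).
Proof.
move=> h; apply: linHom_ext => x /=; rewrite to_cutK linearZ /=.
by rewrite restrict_scaleE secK scale1r.
Qed.

Lemma to_restrictK : cancel (to_restrict : linHom _ _ -> linHom _ _)
  (from_restrict : linHom _ _ -> linHom _ _).
Proof. by move=> h; apply: linHom_ext => x /=; rewrite cut_valK. Qed.
End LeftAdjoint.

(* Hom_A(restrict N, M) = Hom_B(N, cut M) *)
Section RightAdjoint.
Variables (M : lmodType A) (N : lmodType B).

Section Down.
Variable h : {linear restrict g N -> M}.
Fact to_cut_comp_linear : linear (fun x : N => to_cut s (h x)).
Proof.
(* As [b = g (s b)], scaling by [b] on [N] is scaling by [s b] on its restriction, where [h] is
   linear. *)
move=> b x y; rewrite -[b](secK s) -to_cutZ -to_cutD -(linearP h).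
by congr (to_cut s (h _)).
Qed.
Definition to_cut_comp : {linear N -> cut s M} := mk_linear to_cut_comp_linear.
End Down.

Section Up.
Variable h : {linear N -> cut s M}.
Fact cut_val_comp_linear : linear (fun x : restrict g N => cut_val (h x)).
Proof.
by move=> a x y; rewrite restrict_scaleE linearP cut_valD cut_valZg.
Qed.
Definition cut_val_comp : {linear restrict g N -> M} := mk_linear cut_val_comp_linear.
End Up.

Lemma to_cut_compK : cancel (to_cut_comp : linHom _ _ -> linHom _ _)
  (cut_val_comp : linHom _ _ -> linHom _ _).
Proof.
move=> h; apply: linHom_ext => x /=; rewrite to_cutK -linearZ /=.
by rewrite restrict_scaleE secK scale1r.
Qed.

Lemma cut_val_compK : cancel (cut_val_comp : linHom _ _ -> linHom _ _)
  (to_cut_comp : linHom _ _ -> linHom _ _).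
Proof. by move=> h; apply: linHom_ext => x /=; rewrite cut_valK. Qed.
End RightAdjoint.

(** The right adjoint of [cut], restriction, preserves surjections: lift the transpose of [h] and
    transpose back. *)
Lemma projective_cut (P : lmodType A) : projective P -> projective (cut s P).
Proof.
move=> Pproj M N p h p_surj.
have [k pk] := Pproj (restrict g M) (restrict g N) (restrict_map g p)
  (to_restrict h) p_surj.
exists (from_restrict k) => x; rewrite /= [LHS](pk (cut_val x)) /=.
by rewrite cut_valK.
Qed.

Lemma cut_map_surj (M N : lmodType A) (p : {linear M -> N}) :
  surjective p -> surjective (cut_map p).
Proof.
move=> p_surj y; have [x xy] := p_surj (cut_val y).
exists (to_cut s x); apply: cut_val_inj.
by rewrite cut_val_map to_cutK linearZ /= xy sec1_cut_val.
Qed.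

(** Dually, restriction is left adjoint to [cut], which preserves surjections. *)
Lemma projective_restrict (P : lmodType B) :
  projective P -> projective (restrict g P).
Proof.
move=> Pproj M N p h p_surj.
have [k pk] := Pproj (cut s M) (cut s N) (cut_map p) (to_cut_comp h)
  (cut_map_surj p_surj).
exists (cut_val_comp k) => x; rewrite /= -cut_val_map pk /= to_cutK -linearZ /=.
by rewrite restrict_scaleE secK scale1r.
Qed.

Lemma exact_at_cut (M N P : lmodType A) (a : {linear M -> N}) (b : {linear N -> P}) :
  exact_at a b -> exact_at (cut_map a) (cut_map b).
Proof.
move=> ab y; split=> [|[x <-]].
  move/(congr1 (@cut_val _ _ _ s P)); rewrite cut_val_map cut_val0 => /ab[x xy].
  exists (to_cut s x); apply: cut_val_inj.
  by rewrite cut_val_map to_cutK linearZ /= xy sec1_cut_val.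
apply: cut_val_inj; rewrite !cut_val_map cut_val0; apply/ab.
by exists (cut_val x).
Qed.

Definition cut_augmented (U : lmodType A) (X : augmented U) : augmented (cut s U) :=
  @Augmented B (cut s U) (fun i => cut s (X i))
    (fun i => cut_map (bnd X i)) (cut_map (aug X)).

Definition restrict_augmented (U : lmodType B) (X : augmented U) :
    augmented (restrict g U : lmodType A) :=
  @Augmented A (restrict g U) (fun i => restrict g (X i))
    (fun i => restrict_map g (bnd X i)) (restrict_map g (aug X)).

Lemma exact_at_term_cut (U : lmodType A) (X : augmented U) i :
  exact_at_term X i -> exact_at_term (cut_augmented X) i.
Proof. by case: i => [|i]; apply: exact_at_cut. Qed.

Lemma exact_at_term_restrict (U : lmodType B) (X : augmented U) i :
  exact_at_term X i -> exact_at_term (restrict_augmented X) i.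
Proof. by case: i. Qed.

Lemma proj_resolution_cut (U : lmodType A) (X : augmented U) :
  proj_resolution X -> proj_resolution (cut_augmented X).
Proof.
move=> [Xproj Xex Xsurj]; split=> [i|i|]; first exact: projective_cut.
  exact: exact_at_term_cut.
exact: cut_map_surj.
Qed.

Lemma proj_resolution_restrict (U : lmodType B) (X : augmented U) :
  proj_resolution X -> proj_resolution (restrict_augmented X).
Proof.
move=> [Xproj Xex Xsurj]; split=> [i|i|]; first exact: projective_restrict.
  exact: exact_at_term_restrict.
exact: Xsurj.
Qed.

Lemma finite_pd_cut (U : lmodType A) : finite_pd U -> finite_pd (cut s U).
Proof.
move=> [X Xres [m Xm]]; exists (cut_augmented X); first exact: proj_resolution_cut.
by exists m => i im x; apply: cut_val_inj; rewrite cut_val0; apply: Xm.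
Qed.

Lemma finite_pd_restrict (U : lmodType B) :
  finite_pd U -> finite_pd (restrict g U : lmodType A).
Proof.
move=> [X Xres [m Xm]]; exists (restrict_augmented X); last by exists m.
exact: proj_resolution_restrict.
Qed.

Lemma fg_free_cut (F : lmodType A) : fg_free F -> fg_free (cut s F).
Proof.
move=> [k [e [e' eK e'K]]].
(* The cut of [A^k] is [B^k]: apply [s] entrywise one way and [g] the other way. On [A^k] the round
   trip is multiplication by [s 1], the identity on the cut. *)
pose h (v : 'rV[B]_k) : cut s F := to_cut s (e (map_mx s v)).
have hL : linear h.
  move=> b v w; rewrite /h -[b in LHS](secK s) -[b in RHS](secK s) -to_cutZ -to_cutD.
  rewrite -linearP; congr (to_cut s (e _)); apply/rowP => i.
  by rewrite !mxE secD secMl.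
exists k, (mk_linear hL), (fun x => map_mx g (e' (cut_val x))).
  move=> v /=; rewrite to_cutK -linearZ /= eK.
  by apply/rowP => i; rewrite !mxE -secM mul1r secK.
move=> x /=; apply: cut_val_inj; rewrite /h to_cutK.
have -> : s 1 *: e (map_mx s (map_mx g (e' (cut_val x)))) = s 1 *: e (e' (cut_val x)).
  rewrite -!linearZ /=; congr (e _); apply/rowP => i.
  by rewrite !mxE -secM mul1r sec1M.
by rewrite e'K sec1_cut_val.
Qed.

Lemma n_presented_cut n (U : lmodType A) : n_presented U n -> n_presented (cut s U) n.
Proof.
move=> [X [Xfree Xex Xsurj]]; exists (cut_augmented X); split=> [i iN|i iN|].
- exact/fg_free_cut/Xfree.
- exact/exact_at_term_cut/Xex.
- exact: cut_map_surj.
Qed.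

(* The complement (1 - sec 1) A^k is resolved by multiplying A^k alternately by
   sec 1 and 1 - sec 1. *)
Lemma n_presented_compl n k :
  n_presented (ker (sec1_map s 'rV[A]_k) : lmodType A) n.
Proof.
pose E : lmodType A := 'rV[A]_k.
have mem (x : E) : compl_map s E x \in is_ker (sec1_map s E).
  by rewrite unfold_in /= scalerBr scalerA -secM mulr1 subrr.
pose a (x : E) : ker (sec1_map s E) := Ker (mem x).
have aL : linear a by move=> c x y; apply: val_inj; apply: (linearP (compl_map s E)).
(* The augmentation is [1 - s 1], with kernel the image of [s 1]; hence multiplication by [s 1]
   comes first, at the even index 0. *)
pose b i : {linear E -> E} := if odd i then compl_map s E else sec1_map s E.
have ker_compl (y : E) : compl_map s E y = 0 <-> exists x, sec1_map s E x = y.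
  split=> [|[x <-]] /=; last by rewrite scalerA -secM mulr1 subrr.
  by move/eqP; rewrite subr_eq0 => /eqP yE; exists y; rewrite -yE.
exists (@Augmented A (ker (sec1_map s E)) (fun=> E) b (mk_linear aL)).
split=> [i _|i _|y]; first exact: fg_free_rV.
- case: i => [|i] /=.
    move=> y; rewrite -ker_compl; split=> [/(congr1 val)//|yN].
    exact: val_inj.
  rewrite /b /=; case: (odd i) => y /=; first exact: ker_compl.
  split=> [y0|[x <-]]; first by exists y; rewrite y0 subr0.
  by rewrite scalerBr scalerA -secM mulr1 subrr.
- exists (val y); apply: val_inj => /=.
  by rewrite [s 1 *: _](ker_valP y) subr0.
Qed.

(** A cover of [U] by [B^k] with kernel [K] becomes a cover by [A^k]. As [A^k] is the sum of [B^k]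
    and the complement [W], the new kernel is [K * W]; induction handles [K], and
    [n_presented_compl] handles [W]. *)
Lemma n_presented_restrict n (U : lmodType B) :
  n_presented U n -> n_presented (restrict g U : lmodType A) n.
Proof.
(* The composite of [A^k -> B^k], [e] and [p], where the first map is [g] entrywise. *)
have lift (F V : lmodType B) (p : {linear F -> V}) k (e : {linear 'rV[B]_k -> F}) :
    linear (fun v : 'rV[A]_k => p (e (map_mx g v)) : restrict g V).
  move=> a x y; rewrite restrict_scaleE -linearP; congr (p _); rewrite -linearP.
  by congr (e _); apply/rowP => i; rewrite !mxE rmorphD rmorphM.
have lift_surj (F V : lmodType B) (p : {linear F -> V}) k (e : {linear 'rV[B]_k -> F}) :
    surjective p -> bijective e -> surjective (mk_linear (lift F V p k e)).
  move=> p_surj [e' eK e'K] y; have [x <-] := p_surj y.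
  exists (map_mx s (e' x)) => /=; rewrite -[in RHS](e'K x); congr (p (e _)).
  by apply/rowP => i; rewrite !mxE secK.
elim: n U => [|n IH] U.
  move=> /n_presented0[F [k [e e_bij]] [p p_surj]]; apply/n_presented0.
  exists 'rV[A]_k; first exact: fg_free_rV.
  by exists (mk_linear (lift F U p k e)); apply: lift_surj.
move=> /n_presentedS[F [K [i [p [[k [e e_bij]] i_inj ip p_surj]]]]] /IH Kn.
apply/n_presentedS; have [e' eK e'K] := e_bij.
pose W : lmodType A := ker (sec1_map s 'rV[A]_k).
have e'L : linear e' := can2_linear eK e'K.
(* The inclusion of the kernel: [K] sits in [B^k] through [e'], then in [A^k] through [s]. Since [g]
   kills [W], applying [g] recovers the first component. *)
pose j (x : restrict g K * W) : 'rV[A]_k := map_mx s (e' (i x.1)) + val x.2.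
have jL : linear j.
  move=> a x y; rewrite /j /= scalerDr addrACA; congr (_ + _).
  apply/rowP => l; rewrite restrict_scaleE linearP e'L !mxE.
  by rewrite secD secMl.
have gW (w : W) : map_mx g (val w) = 0.
  apply/rowP => l; have /rowP/(_ l) := ker_valP w.
  by rewrite !mxE sec1M => /(congr1 g); rewrite secK rmorph0.
have gj x : map_mx g (j x) = e' (i x.1).
  rewrite /j map_mxD gW addr0; apply/rowP => l; rewrite !mxE; exact: secK.
exists 'rV[A]_k, (restrict g K * W)%type, (mk_linear jL), (mk_linear (lift F U p k e)).
split; first exact: fg_free_rV.
- move=> x y /= xy; have x1 : x.1 = y.1.
    by apply/i_inj/(can_inj e'K); rewrite -!gj xy.
  move: xy; rewrite /j x1 => /addrI/val_inj; move: x1.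
  by case: x y => [? ?] [? ?] /= -> ->.
- move=> v; split=> [/ip[x xv]|[x <-]] /=; last first.
    by rewrite gj e'K; apply/ip; exists x.1.
  (* Split [v] along the idempotent: [s 1 *: v] comes from [x] in [K], and the rest lies in [W]. *)
  have mem : v - s 1 *: v \in is_ker (sec1_map s 'rV[A]_k).
    by rewrite unfold_in /= scalerBr scalerA -secM mulr1 subrr.
  exists (x, Ker mem : W); rewrite /j /= xv eK addrC -[RHS](subrK (s 1 *: v)).
  by congr (_ + _); apply/rowP => l; rewrite !mxE sec1M.
- exact: lift_surj.
- exact/n_presented_prod/n_presented_compl.
Qed.

End Adjunctions.

(** * Transfer of injectivity and of the Gorenstein property along both functors *)

Section Transfer.
Variables (A B : nzRingType) (g : {rmorphism A -> B}) (s : bimodule_section g).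
Variables n d : nat.

Section LeftAdjointIso.
Variables (U : lmodType A) (X : augmented U) (N : lmodType B).

Fact from_restrictB k :
  {morph (fun h : linHom (X k) (restrict g N) => from_restrict s h : linHom _ _) :
    h l / h - l}.
Proof. by move=> h l; apply: linHom_ext. Qed.

Fact from_restrict_bij k :
  bijective (fun h : linHom (X k) (restrict g N) => from_restrict s h : linHom _ _).
Proof.
exists (fun h : linHom _ _ => to_restrict h : linHom _ _).
  exact: from_restrictK.
exact: to_restrictK.
Qed.

Fact from_restrict_bnd k (h : {linear X k -> restrict g N}) :
  from_restrict s (h \o bnd X k) =
  from_restrict s h \o bnd (cut_augmented s X) k :> {linear _ -> _}.
Proof.
apply: linHom_ext => x.
exact: (congr1 h (esym (cut_val_map (s := s) (bnd X k) x))).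
Qed.

(** For a projective resolution [X] this yields [Ext_A(U, restrict g N) = Ext_B(cut s U, N)]. *)
Definition from_restrict_iso :
    hom_complex_iso X (cut_augmented s X) (restrict g N) N :=
  @HomComplexIso _ _ _ _ X (cut_augmented s X) (restrict g N) N
    (fun k h => from_restrict s h) from_restrictB from_restrict_bij from_restrict_bnd.
End LeftAdjointIso.

Section RightAdjointIso.
Variables (U : lmodType B) (X : augmented U) (M : lmodType A).

Fact cut_val_compB k :
  {morph (fun h : linHom (X k) (cut s M) => cut_val_comp h : linHom _ _) :
    h l / h - l}.
Proof. by move=> h l; apply: linHom_ext => x; apply: cut_valB. Qed.

Fact cut_val_comp_bij k :
  bijective (fun h : linHom (X k) (cut s M) => cut_val_comp h : linHom _ _).
Proof.
exists (fun h : linHom _ _ => to_cut_comp s h : linHom _ _).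
  exact: cut_val_compK.
exact: to_cut_compK.
Qed.

Fact cut_val_comp_bnd k (h : {linear X k -> cut s M}) :
  cut_val_comp (h \o bnd X k) =
  cut_val_comp h \o bnd (restrict_augmented g X) k :> {linear _ -> _}.
Proof. exact: linHom_ext. Qed.

(** For a projective resolution [X] this yields [Ext_B(U, cut s M) = Ext_A(restrict g U, M)]. *)
Definition cut_val_comp_iso :
    hom_complex_iso X (restrict_augmented g X) (cut s M) M :=
  @HomComplexIso _ _ _ _ X (restrict_augmented g X) (cut s M) M
    (fun k h => cut_val_comp h) cut_val_compB cut_val_comp_bij cut_val_comp_bnd.
End RightAdjointIso.

Lemma nd_injective_restrict (N : lmodType B) :
  nd_injective n d N -> nd_injective n d (restrict g N : lmodType A).
Proof.
move=> Ninj U Un X Xres; apply: (hom_iso_Ext_eq0 (from_restrict_iso X N)).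
by apply: Ninj; [apply: n_presented_cut | apply: proj_resolution_cut].
Qed.

Lemma nd_injective_cut (M : lmodType A) :
  nd_injective n d M -> nd_injective n d (cut s M).
Proof.
move=> Minj U Un X Xres; apply: (hom_iso_Ext_eq0 (cut_val_comp_iso X M)).
apply: Minj; [exact: (n_presented_restrict s) | exact: (proj_resolution_restrict s)].
Qed.

(** The witnessing complex is restricted termwise, while test modules travel the other way: [U] over
    [A] is tested through [cut s U], again n-presented of finite projective dimension. *)
Lemma Gorenstein_nd_injective_restrict (G : lmodType B) :
  Gorenstein_nd_injective n d G ->
  Gorenstein_nd_injective n d (restrict g G : lmodType A).
Proof.
move=> [C [D [Cinj Cex [iota [iota_inj iotaD]] Cext]]].
exists (fun i => restrict g (C i)), (fun i => restrict_map g (D i)); split.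
- by move=> i; apply: nd_injective_restrict.
- exact: Cex.
- by exists (restrict_map g iota).
- move=> U Un Upd X Xres i.
  apply: (hom_iso_Ext_exact (phiM := from_restrict_iso X (C i))
    (phiN := from_restrict_iso X _) (phiP := from_restrict_iso X _)).
  + by move=> h; apply: linHom_ext.
  + by move=> h; apply: linHom_ext.
  apply: Cext; [exact: n_presented_cut | exact: finite_pd_cut |].
  exact: proj_resolution_cut.
Qed.

(** The same exchange with the roles swapped: the complex is cut and test modules are restricted. *)
Lemma Gorenstein_nd_injective_cut (G : lmodType A) :
  Gorenstein_nd_injective n d G -> Gorenstein_nd_injective n d (cut s G).
Proof.
move=> [C [D [Cinj Cex [iota [iota_inj iotaD]] Cext]]].
exists (fun i => cut s (C i)), (fun i => cut_map s (D i)); split.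
- by move=> i; apply: nd_injective_cut.
- by move=> i; apply: exact_at_cut.
- exists (cut_map s iota); split; last exact: exact_at_cut.
  move=> x y /(congr1 (@cut_val _ _ _ _ _)); rewrite !cut_val_map => /iota_inj.
  exact: cut_val_inj.
- move=> U Un Upd X Xres i.
  apply: (hom_iso_Ext_exact (phiM := cut_val_comp_iso X (C i))
    (phiN := cut_val_comp_iso X _) (phiP := cut_val_comp_iso X _)).
  + by move=> h; apply: linHom_ext => x; apply: cut_val_map.
  + by move=> h; apply: linHom_ext => x; apply: cut_val_map.
  apply: Cext; [exact: (n_presented_restrict s) | exact: (finite_pd_restrict s) |].
  exact: (proj_resolution_restrict s).
Qed.

End Transfer.

(** * Invariance under isomorphism and under restriction *)

Lemma Gorenstein_nd_injective_iso (T : nzRingType) (n d : nat) (G H : lmodType T)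
    (e : {linear G -> H}) :
  bijective e -> Gorenstein_nd_injective n d H -> Gorenstein_nd_injective n d G.
Proof.
move=> [e' eK e'K] [C [D [Cinj Cex [iota [iota_inj iotaD]] Cext]]].
(* The complex is kept; only the embedding of its kernel changes. *)
exists C, D; split=> //; exists (iota \o e : {linear _ -> _}); split.
  by move=> x y /iota_inj/(can_inj eK).
move=> y; rewrite iotaD; split=> [[x <-]|[x <-]]; last by exists (e x).
by exists (e' x); rewrite /= e'K.
Qed.

Lemma Gorenstein_nd_injective_isoP (T : nzRingType) (n d : nat) (G H : lmodType T)
    (e : {linear G -> H}) : bijective e ->
  Gorenstein_nd_injective n d G <-> Gorenstein_nd_injective n d H.
Proof.
move=> e_bij; split; last exact: Gorenstein_nd_injective_iso e_bij.
have [e' eK e'K] := e_bij.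
apply: (@Gorenstein_nd_injective_iso T n d H G (mk_linear (can2_linear eK e'K))).
by exists e.
Qed.

(** Cutting undoes restriction: [s 1] acts on [restrict g G] as [g (s 1) = 1], so the transpose of
    the identity is an isomorphism from [G] onto its cut. *)
Lemma Gorenstein_nd_injective_restrictP (A B : nzRingType) (g : {rmorphism A -> B})
    (s : bimodule_section g) (n d : nat) (G : lmodType B) :
  Gorenstein_nd_injective n d (restrict g G : lmodType A) <->
  Gorenstein_nd_injective n d G.
Proof.
split; last exact: Gorenstein_nd_injective_restrict.
move/(Gorenstein_nd_injective_cut s); apply: (@Gorenstein_nd_injective_iso B n d G _
  (to_cut_comp s (idfun : {linear restrict g G -> restrict g G}))).
have valto x : cut_val (to_cut s (x : restrict g G)) = x.
  by rewrite to_cutK restrict_scaleE secK scale1r.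
exists (fun x : cut s (restrict g G) => cut_val x : G) => x.
  exact: valto.
exact: cut_valK.
Qed.

(** * The bimodule section of [f], and evaluation at 1 on [Hom_R(S, G)] *)

Section Surjection.
Variables (R S : nzRingType) (f : {rmorphism R -> S}).

(* The images a, b of 1 under a right and a left linear section coincide: as
   f a = f b = 1, right linearity gives a = a b and left linearity b = a b.
   Hence the two sections are equal. *)
Lemma bimodule_section_exists :
  surjective f -> projective (right_reg f) -> projective (left_reg f) ->
  inhabited (bimodule_section (converse_morph f)).
Proof.
move=> f_surj right_proj left_proj.
have fr_lin : linear (f : GRing.regular R^c -> right_reg f).
  by move=> a x y; rewrite rmorphD rmorphM.
have fl_lin : linear (f : GRing.regular R -> left_reg f).
  by move=> a x y; rewrite rmorphD rmorphM.
(* Lifting the identity of [S] along [f] gives one section for each side. *)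
have [u fu] := right_proj _ _ (mk_linear fr_lin) idfun f_surj.
have [v fv] := left_proj _ _ (mk_linear fl_lin) idfun f_surj.
have uZ (x : S) (r : R) : u (x * f r) = (u x : R) * r by exact: (linearZZ u r x).
have vZ (x : S) (r : R) : v (f r * x) = r * (v x : R) by exact: (linearZZ v r x).
pose a : R := u (1 : S); pose b : R := v (1 : S).
have fa : f a = 1 := fu 1.
have fb : f b = 1 := fv 1.
have ar r : u (f r) = a * r by rewrite -[f r]mul1r uZ.
have rb r : v (f r) = r * b by rewrite -[f r]mulr1 vZ.
have ab : a = b.
  have aab : a = a * b by rewrite -ar fb.
  by rewrite aab -rb fa.
have uv (x : S) : u x = v x.
  (* As [f a = 1], both [r * a] and [a * r] have image [f r]; therefore [a * r] and [r * a] both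
     equal [a * r * a]. *)
  have [r <-] := f_surj x; rewrite ar rb.
  have -> : a * r = a * r * a :> R by rewrite -mulrA -[RHS]ar rmorphM fa mulr1 ar.
  by rewrite [in LHS]ab -rb rmorphM fb mul1r rb.
have uB : {morph (u : S^c -> R^c) : x y / x - y} by exact: (raddfB u).
(* Products are reversed in the converse rings: left linearity there is right linearity of [u], and
   right linearity there is left linearity of [v]. *)
have uMl (r : R^c) (x : S^c) : u (converse_morph f r * x) = r * (u x : R^c).
  exact: uZ.
have uMr (r : R^c) (x : S^c) : u (x * converse_morph f r) = (u x : R^c) * r.
  by rewrite !uv; exact: vZ.
have uK : cancel (u : S^c -> R^c) (converse_morph f) by exact: fu.
exact: inhabits (BimoduleSection uB uMl uMr uK).
Qed.

(** Every scalar of [S] is some [f r], so R-linearity of [phi] already moves it out of [phi]. *)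
Lemma HomRS_eval_linear (G : rmodType S) :
  surjective f ->
  linear (fun phi : HomRS f G => (phi : {linear right_reg f -> G_R f G}) (1 : S) : G).
Proof.
move=> f_surj x phi psi.
have phiZ r : (phi : {linear right_reg f -> G_R f G}) (f r : S) =
    (f r : S^c) *: ((phi : {linear right_reg f -> G_R f G}) (1 : S) : G).
  by rewrite -[f r in LHS]mul1r; exact: (linearZZ (phi : {linear _ -> _}) r (1 : S)).
have [r <-] := f_surj x; rewrite -phiZ /=; congr (_ + _).
by congr ((phi : {linear right_reg f -> G_R f G}) _); exact: (@mulr1 S (f r)).
Qed.

(** By surjectivity of [f], [phi] is determined by its value at 1; the inverse sends [y] to the
    orbit map [x] to [y.x]. *)
Lemma HomRS_eval_bij (G : rmodType S) (f_surj : surjective f) :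
  bijective (mk_linear (HomRS_eval_linear (G := G) f_surj)).
Proof.
have lin (y : G) : linear (fun x : right_reg f => ((x : S^c) *: y : G) : G_R f G).
  by move=> r x z; rewrite scalerDl -scalerA.
exists (fun y => mk_linear (lin y) : linHom _ _) => [phi|y] /=; last exact: scale1r.
apply: linHom_ext => x /=; have [r <-] := f_surj x.
rewrite -[in RHS](mul1r (f r : S)).
by rewrite -[LHS](linearZZ (phi : {linear _ -> _}) r (1 : S)).
Qed.

End Surjection.

Theorem theorem4p4 (n d : nat) (R S : nzRingType) (f : {rmorphism R -> S})
    (f_surj : surjective f)
    (S_proj_right : projective (right_reg f))
    (S_proj_left : projective (left_reg f))
    (G : rmodType S) :
  [<-> Gorenstein_nd_injective n d (G_R f G);
       Gorenstein_nd_injective n d (HomRS f G : rmodType S);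
       Gorenstein_nd_injective n d G].
Proof.
have [s] := bimodule_section_exists f_surj S_proj_right S_proj_left.
have GR := Gorenstein_nd_injective_restrictP s n d G.
have GH := Gorenstein_nd_injective_isoP n d (HomRS_eval_bij G f_surj).
(* Both (1) and (2) are compared with (3), so the implication from (1) to (2) passes through (3). *)
tfae; [by move/GR/GH | by move/GH | by move/GR].
Qed.
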